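(* (i) Let $D\subseteq\mathbb{R}$, let $S_1,S_2\in\mathbb{R}$ be constants, and let $f:D\to\mathbb{R}$ be a function such that for every $x\in D$ we have $f(x)+S_1\in D$ and $f(f(x)+S_1)=x+S_2$. Put $K=S_1+S_2$. Then for every $x\in D$ we have $x+K\in D$ and $f(x+K)=f(x)+K$. (ii) Let $D\subseteq\mathbb{R}$, let $c,d\in\mathbb{R}$ be constants, and let $f:D\to\mathbb{R}$ be a function such that for every $x\in D$ we have $x+c\in D$ and $f(x+c)=f(x)+d$. Then $f(x+Nc)=f(x)+Nd$ for every $x\in D$ and every natural number $N$. *)

(* Defs.v *)
From mathcomp Require Import all_boot all_order all_algebra.
From mathcomp Require Import classical_sets reals.

(* A function f : D -> R with D a subset of R is represented by a total
   function f : R -> R that is constrained, and whose values are asserted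
   about, only at points of D. *)

(* Main.v *)
Require Import Defs.
From mathcomp Require Import all_boot all_order all_algebra.
From mathcomp Require Import classical_sets reals.
Import Order.TTheory GRing.Theory Num.Theory.
Local Open Scope classical_set_scope.
Local Open Scope ring_scope.

Theorem mainTheorem1 (R : realType) :
  (forall (D : set R) (S1 S2 : R) (f : R -> R),
     (forall x : R, D x -> D (f x + S1) /\ f (f x + S1) = x + S2) ->
     let K := S1 + S2 in
     forall x : R, D x -> D (x + K) /\ f (x + K) = f x + K)
  /\
  (forall (D : set R) (c d : R) (f : R -> R),
     (forall x : R, D x -> D (x + c) /\ f (x + c) = f x + d) ->
     forall (x : R) (N : nat), D x ->
       D (x + N%:R * c) /\ f (x + N%:R * c) = f x + N%:R * d).
Proof.
split=> [D S1 S2 f Hf K x Dx | D c d f Hf x N Dx].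
  (* The map g y = f y + S1 sends D to D and satisfies g (g x) = x + K, so
     applying the hypothesis at x and then at g x gives both claims. *)
  have [Dgx fgx] := Hf x Dx.
  have := Hf _ Dgx.
  by rewrite fgx -addrA (addrC S2) -addrA.
elim: N => [|N [DN fN]]; first by rewrite !mul0r !addr0.
by rewrite -natr1 !mulrDl !mul1r !addrA -fN; apply: Hf.
Qed.
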